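(* Let $\Omega_c$ be a commutative semigroup and let $(A,\prec_{\omega_1,\omega_2},\succ_{\omega_1,\omega_2},\Omega_c)$ be an $\Omega_c$-relative pre-anti-flexible algebra. For all $\alpha,\beta\in\Omega_c$ and $x,y\in A$ define $$x\blacktriangleleft_{\alpha,\beta}y = x\prec_{\alpha,\beta}y - y\succ_{\beta,\alpha}x .$$ Then $(A,\blacktriangleleft_{\alpha,\beta},\Omega_c)$ is an $\Omega_c$-relative right pre-Lie algebra.
   Context: Standing conventions: $\Omega_c$ is a commutative associative semigroup; $A$ is a finite-dimensional vector space over a field of characteristic zero; all operations on $A$ are bilinear. An $\Omega_c$-relative pre-anti-flexible algebra is a vector space $A$ with bilinear operations $\prec_{\alpha,\beta},\succ_{\alpha,\beta}:A\times A\to A$ for each $(\alpha,\beta)\in\Omega_c^2$ such that for all $x,y,z\in A$ and $\alpha,\beta,\gamma\in\Omega_c$: $$(x\succ_{\alpha,\beta}y)\prec_{\alpha\beta,\gamma}z - x\succ_{\alpha,\beta\gamma}(y\prec_{\beta,\gamma}z) = (z\succ_{\gamma,\beta}y)\prec_{\gamma\beta,\alpha}x - z\succ_{\gamma,\beta\alpha}(y\prec_{\beta,\alpha}x),$$ $$(x\prec_{\alpha,\beta}y + x\succ_{\alpha,\beta}y)\succ_{\alpha\beta,\gamma}z - x\succ_{\alpha,\beta\gamma}(y\succ_{\beta,\gamma}z) = (z\prec_{\gamma,\beta}y)\prec_{\gamma\beta,\alpha}x - z\prec_{\gamma,\beta\alpha}(y\prec_{\beta,\alpha}x + y\succ_{\beta,\alpha}x).$$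 An $\Omega_c$-relative right pre-Lie algebra is a vector space $A$ with bilinear operations $\cdot_{\alpha,\beta}$ for each $(\alpha,\beta)\in\Omega_c^2$ such that for all $x,y,z\in A$ and $\alpha,\beta,\gamma\in\Omega_c$: $$(x\cdot_{\alpha,\beta}y)\cdot_{\alpha\beta,\gamma}z - x\cdot_{\alpha,\beta\gamma}(y\cdot_{\beta,\gamma}z) = (x\cdot_{\alpha,\gamma}z)\cdot_{\alpha\gamma,\beta}y - x\cdot_{\alpha,\gamma\beta}(z\cdot_{\gamma,\beta}y).$$ *)

(* Defs.v *)
From HB Require Import structures.
From mathcomp Require Import all_boot all_algebra.

Set Implicit Arguments.
Unset Strict Implicit.
Unset Printing Implicit Defensive.

Import GRing.Theory.
Local Open Scope ring_scope.

(* The commutative semigroup is given by its product, a [SemiGroup.com_law]    *)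
(* on the carrier [Omega].  A family of operations [f] on [A] indexed by pairs *)
(* of elements of [Omega] is applied as [f a b x y], for x f_{a,b} y.          *)

Record is_relative_pre_antiflexible (Omega : Type)
    (mul : SemiGroup.com_law Omega) (K : fieldType) (A : lmodType K)
    (prec succ : Omega -> Omega -> A -> A -> A) : Prop := {
  prec_bilinear : forall a b : Omega, bilinear_for *:%R *:%R (prec a b);
  succ_bilinear : forall a b : Omega, bilinear_for *:%R *:%R (succ a b);
  pre_antiflexible_succ_prec : forall (a b c : Omega) (x y z : A),
    prec (mul a b) c (succ a b x y) z - succ a (mul b c) x (prec b c y z) =
    prec (mul c b) a (succ c b z y) x - succ c (mul b a) z (prec b a y x);
  pre_antiflexible_succ_succ : forall (a b c : Omega) (x y z : A),
    succ (mul a b) c (prec a b x y + succ a b x y) z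
      - succ a (mul b c) x (succ b c y z) =
    prec (mul c b) a (prec c b z y) x
      - prec c (mul b a) z (prec b a y x + succ b a y x)
}.

Record is_relative_right_pre_Lie (Omega : Type)
    (mul : SemiGroup.com_law Omega) (K : fieldType) (A : lmodType K)
    (dot : Omega -> Omega -> A -> A -> A) : Prop := {
  dot_bilinear : forall a b : Omega, bilinear_for *:%R *:%R (dot a b);
  right_pre_Lie : forall (a b c : Omega) (x y z : A),
    dot (mul a b) c (dot a b x y) z - dot a (mul b c) x (dot b c y z) =
    dot (mul a c) b (dot a c x z) y - dot a (mul c b) x (dot c b z y)
}.

Definition btleft (Omega : Type) (K : fieldType) (A : lmodType K)
    (prec succ : Omega -> Omega -> A -> A -> A) (a b : Omega) (x y : A) : A :=
  prec a b x y - succ b a y x.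

(* Main.v *)
(* Write < for [prec] and > for [succ].  The second axiom at (z, y, x)         *)
(* eliminates (x < y) < z and z > (y > x) from the associator of [btleft] at   *)
(* (x, y, z).  What remains is symmetric in y and z except for                 *)
(* (y > x) < z + z > (x < y), whose symmetry is the first axiom at (y, x, z).  *)
Require Import Defs.
From HB Require Import structures.
From mathcomp Require Import all_boot all_algebra.

Set Implicit Arguments.
Unset Strict Implicit.
Unset Printing Implicit Defensive.

Import GRing.Theory.
Local Open Scope ring_scope.

(** Right pre-Lie says that the associator is unchanged when [(y, b)] and [(z, c)] are swapped.
    [btleft_associator] rewrites it by the second axiom as three sums of two terms, each sum
    invariant under this swap: two by commutativity of addition, the third by the first axiom.
    Commutativity of [mul] matches the indices. *)

Section Btleft.

Variables (Omega : Type) (mul : SemiGroup.com_law Omega).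
Variables (K : fieldType) (A : lmodType K).
Variables prec succ : Omega -> Omega -> A -> A -> A.
Hypothesis preAF : is_relative_pre_antiflexible mul prec succ.

HB.instance Definition _ a b := bilinear_isBilinear.Build K A A A _ _
  (prec a b) (prec_bilinear preAF a b).
HB.instance Definition _ a b := bilinear_isBilinear.Build K A A A _ _
  (succ a b) (succ_bilinear preAF a b).

Local Notation mulC := (SemiGroup.opC (s := mul)).
Local Notation btleft := (btleft prec succ).

Lemma btleft_bilinear a b : bilinear_for *:%R *:%R (btleft a b).
Proof.
split=> z k x y; rewrite /Defs.btleft linearPl linearPr /=;
  by rewrite scalerBr opprD addrACA.
Qed.

Lemma btleft_associator a b c x y z :
  btleft (mul a b) c (btleft a b x y) z
    - btleft a (mul b c) x (btleft b c y z) =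
  (succ (mul b c) a (prec b c y z) x + succ (mul b c) a (prec c b z y) x)
  + (prec a (mul b c) x (succ b c y z) + prec a (mul b c) x (succ c b z y))
  - (prec (mul a b) c (succ b a y x) z + succ c (mul a b) z (prec a b x y)).
Proof.
rewrite /Defs.btleft linearBl linearBr /= linearBr linearBl /=.
have := pre_antiflexible_succ_succ preAF c b a z y x.
rewrite linearDl linearDr /= (mulC c b) (mulC b a).
move/(canRL (subrK _)) => /(canRL (addrK _)) ->.
rewrite !opprD !opprK !addrA.
(* The axiom was solved for [(z < y) > x]. The permutation puts the terms in the order of the
   expanded associator, with [x < (y > z)] and its opposite last, where they cancel. *)
by rewrite [RHS](ACl (2*9*10*5*3*8*1*6*7*4)) /= addrK.
Qed.

Lemma btleft_right_pre_Lie : is_relative_right_pre_Lie mul btleft.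
Proof.
split; first exact: btleft_bilinear.
move=> a b c x y z; rewrite !btleft_associator.
have := pre_antiflexible_succ_prec preAF b a c y x z.
rewrite (mulC b a) (mulC c a) (mulC c b).
move/(canRL (subrK _)) => symm; congr (_ + _ - _); first exact: addrC.
  exact: addrC.
by rewrite symm addrAC subrK.
Qed.

End Btleft.

Theorem proposition3p8 (Omega : Type) (mul : SemiGroup.com_law Omega)
    (K : fieldType) (charK0 : [pchar K] =i pred0) (A : vectType K)
    (prec succ : Omega -> Omega -> A -> A -> A)
    (preAF : is_relative_pre_antiflexible mul prec succ) :
  is_relative_right_pre_Lie mul (btleft prec succ).
Proof. exact: btleft_right_pre_Lie. Qed.
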